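(* Let $(\mathbf x_k,\mathbf z_k,\boldsymbol\lambda_k)_{k\ge 0}$, $\boldsymbol\lambda_k=[\boldsymbol\alpha_k;\boldsymbol\beta_k]$, be generated by the DLM recursion (see context) with constants $c>0$ and $\rho>0$, and suppose the following hold. (1) Initialization: $\boldsymbol\alpha_0=-\boldsymbol\beta_0$, $\mathbf E_u\mathbf x_0=2\mathbf z_0$, and $\boldsymbol\alpha_0$ lies in the column space of $\mathbf E_o$. (2) Network: every singular value $\sigma(\mathbf E_u)$ of $\mathbf E_u$ satisfies $0<\gamma_u\le\sigma(\mathbf E_u)\le\Gamma_u$ for constants $\gamma_u,\Gamma_u$, and $\gamma_o>0$ is the smallest non-zero singular value of $\mathbf E_o$. (3) Each $f_i$ is twice differentiable and there are constants $0<m\le M<\infty$ with $m\mathbf I\preceq\nabla^2 f_i(\mathbf y)\preceq M\mathbf I$ for all $\mathbf y\in\mathbb R^p$ and all $i$. (4) There is a constant $L$ with $\|\nabla^2 f_i(\mathbf y)-\nabla^2 f_i(\hat{\mathbf y})\|\le L\|\mathbf y-\hat{\mathbf y}\|$ for all $\mathbf y,\hat{\mathbf y}\in\mathbb R^p$ and all $i$. Define the DLM error vector $$\mathbf e_k^{DLM}:=\nabla f(\mathbf x_k)+\rho(\mathbf x_{k+1}-\mathbf x_k)-\nabla f(\mathbf x_{k+1}).$$ Then for all $k\ge 0$ $$\|\mathbf e_k^{DLM}\|\le(\rho+M)\|\mathbf x_{k+1}-\mathbf x_k\|.$$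
   Context: Network and matrices. Consider a connected network with node set $\mathcal V=\{1,\dots,n\}$ and a set $\mathcal E$ of $r$ ordered edges $(i,j)$, symmetric in the sense that $(i,j)\in\mathcal E$ iff $(j,i)\in\mathcal E$. The block source matrix $\mathbf A_s\in\mathbb R^{rp\times np}$ consists of $r\times n$ blocks of size $p\times p$, indexed by edges $e$ and nodes $i$: $(\mathbf A_s)_{e,i}=\mathbf I_p$ if $e=(i,j)\in\mathcal E$ for some $j$, and $\mathbf 0$ otherwise. The block destination matrix $\mathbf A_d\in\mathbb R^{rp\times np}$ has $(\mathbf A_d)_{e,i}=\mathbf I_p$ if $e=(j,i)\in\mathcal E$ for some $j$, and $\mathbf 0$ otherwise. Set $\mathbf A=[\mathbf A_s;\mathbf A_d]\in\mathbb R^{2rp\times np}$ and $\mathbf B=[-\mathbf I_{rp};-\mathbf I_{rp}]\in\mathbb R^{2rp\times rp}$ (semicolons denote vertical stacking), $\mathbf E_o=\mathbf A_s-\mathbf A_d$ (oriented incidence matrix), $\mathbf E_u=\mathbf A_s+\mathbf A_d$ (unoriented incidence matrix). Objective. $f_i:\mathbb R^p\to\mathbb R$ are the local costs; for $\mathbf x=[\mathbf x_1;\dots;\mathbf x_n]\in\mathbb R^{np}$, $f(\mathbf x)=\sum_{i=1}^n f_i(\mathbf x_i)$. DLM recursion with constants $c,\rho>0$: with $\mathbf z_k\in\mathbb R^{rp}$ and $\boldsymbol\lambda_k=[\boldsymbol\alpha_k;\boldsymbol\beta_k]$, $\boldsymbol\alpha_k,\boldsymbol\beta_k\in\mathbb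 R^{rp}$, for all $k\ge 0$, $$\mathbf x_{k+1}=\arg\min_{\mathbf x}\; f(\mathbf x_k)+\nabla f(\mathbf x_k)^T(\mathbf x-\mathbf x_k)+\tfrac\rho2\|\mathbf x-\mathbf x_k\|^2+\boldsymbol\lambda_k^T(\mathbf A\mathbf x+\mathbf B\mathbf z_k)+\tfrac c2\|\mathbf A\mathbf x+\mathbf B\mathbf z_k\|^2,$$ $$\mathbf z_{k+1}=\arg\min_{\mathbf z}\; f(\mathbf x_{k+1})+\boldsymbol\lambda_k^T(\mathbf A\mathbf x_{k+1}+\mathbf B\mathbf z)+\tfrac c2\|\mathbf A\mathbf x_{k+1}+\mathbf B\mathbf z\|^2,$$ $$\boldsymbol\lambda_{k+1}=\boldsymbol\lambda_k+c(\mathbf A\mathbf x_{k+1}+\mathbf B\mathbf z_{k+1}).$$ Norms are Euclidean for vectors and spectral for matrices. *)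

(* Defs.v *)
From mathcomp Require Import all_boot all_order all_algebra.
From mathcomp Require Import all_classical all_reals all_analysis.
Set Implicit Arguments.
Unset Strict Implicit.
Unset Printing Implicit Defensive.
Import Order.TTheory GRing.Theory Num.Theory.
Import numFieldNormedType.Exports.
Local Open Scope classical_set_scope.
Local Open Scope ring_scope.

(* The size of k stacked blocks of size p, in the form used by \mxblock and
   submxcol; a vector of R^(kp) is a column of type 'cV[R]_(blocks k p), and
   its i-th block is submxcol x i. *)
Notation blocks k p := (\sum_(i < k) p)%N.

Section Euclidean.
Context {R : realType}.

Definition dotv n (u v : 'cV[R]_n) : R := (u^T *m v) 0 0.

(* The norm `|v| of the library on matrices is the sup norm. *)
Definition enorm n (v : 'cV[R]_n) : R := Num.sqrt (dotv v v).

Definition spectral_norm m n (A : 'M[R]_(m, n)) : R :=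
  sup [set enorm (A *m v) | v in [set v : 'cV[R]_n | enorm v <= 1]].

(* Since u and v both have to be unit vectors, these are exactly the min(m, n)
   values of a singular value decomposition of A. *)
Definition singular_value m n (A : 'M[R]_(m, n)) (s : R) : Prop :=
  0 <= s /\ exists (u : 'cV[R]_m) (v : 'cV[R]_n),
    [/\ enorm u = 1, enorm v = 1, A *m v = s *: u & A^T *m u = s *: v].

(* Used only between symmetric matrices: scalar matrices and Hessians of twice
   differentiable functions. *)
Definition loewner_le n (A B : 'M[R]_n) : Prop :=
  forall v : 'cV[R]_n, 0 <= dotv v ((B - A) *m v).

Definition column_space m n (A : 'M[R]_(m, n)) : set 'cV[R]_m :=
  range (fun y : 'cV[R]_n => A *m y).

Definition grad n (f : 'cV[R]_n -> R) (x : 'cV[R]_n) : 'cV[R]_n :=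
  \col_i 'D_(delta_mx i 0) f x.

Definition hessian n (f : 'cV[R]_n -> R) (x : 'cV[R]_n) : 'M[R]_n :=
  \matrix_(i, j) 'D_(delta_mx j 0) (fun y => 'D_(delta_mx i 0) f y) x.

Definition twice_differentiable n (f : 'cV[R]_n -> R) : Prop :=
  (forall x, differentiable f x) /\ (forall x, differentiable (grad f) x).

Definition is_argmin n (F : 'cV[R]_n -> R) (x : 'cV[R]_n) : Prop :=
  forall y, F x <= F y.

End Euclidean.

Section Network.
Context {n r : nat}.

(* The r ordered edges are enumerated, in any order and without repetition, by
   edge; the edge set is codom edge. *)
Definition connected_network (edge : 'I_r -> 'I_n * 'I_n) : Prop :=
  [/\ injective edge,
      (forall i j, ((i, j) \in codom edge) = ((j, i) \in codom edge)) &
      (forall i j, connect (fun i j => (i, j) \in codom edge) i j)].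

Variables (R : realType) (p : nat) (edge : 'I_r -> 'I_n * 'I_n).

Definition source_mx : 'M[R]_(blocks r p, blocks n p) :=
  \mxblock_(e < r, i < n)
    (if (edge e).1 == i then 1%:M else 0 : 'M[R]_(p, p)).

Definition destination_mx : 'M[R]_(blocks r p, blocks n p) :=
  \mxblock_(e < r, i < n)
    (if (edge e).2 == i then 1%:M else 0 : 'M[R]_(p, p)).

Definition oriented_incidence := source_mx - destination_mx.

Definition unoriented_incidence := source_mx + destination_mx.

Definition A_mx : 'M[R]_(blocks r p + blocks r p, blocks n p) :=
  col_mx source_mx destination_mx.

Definition B_mx : 'M[R]_(blocks r p + blocks r p, blocks r p) :=
  col_mx (- 1%:M) (- 1%:M).

End Network.

Section DLM.
Context {R : realType} {n r p : nat}.

Definition aggregate (f : 'I_n -> 'cV[R]_p -> R) (x : 'cV[R]_(blocks n p)) : R :=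
  \sum_i f i (submxcol x i).

Definition dlm_x_objective (edge : 'I_r -> 'I_n * 'I_n)
    (f : 'I_n -> 'cV[R]_p -> R) (c rho : R) (xk : 'cV[R]_(blocks n p))
    (zk : 'cV[R]_(blocks r p)) (lamk : 'cV[R]_(blocks r p + blocks r p))
    (x : 'cV[R]_(blocks n p)) : R :=
  let F := aggregate f in
  let res := A_mx R p edge *m x + B_mx R p *m zk in
  F xk + dotv (grad F xk) (x - xk) + rho / 2 * enorm (x - xk) ^+ 2
  + dotv lamk res + c / 2 * enorm res ^+ 2.

Definition dlm_z_objective (edge : 'I_r -> 'I_n * 'I_n)
    (f : 'I_n -> 'cV[R]_p -> R) (c : R) (xk1 : 'cV[R]_(blocks n p))
    (lamk : 'cV[R]_(blocks r p + blocks r p))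
    (z : 'cV[R]_(blocks r p)) : R :=
  let res := A_mx R p edge *m xk1 + B_mx R p *m z in
  aggregate f xk1 + dotv lamk res + c / 2 * enorm res ^+ 2.

Definition dlm_recursion (edge : 'I_r -> 'I_n * 'I_n)
    (f : 'I_n -> 'cV[R]_p -> R) (c rho : R)
    (x : nat -> 'cV[R]_(blocks n p)) (z : nat -> 'cV[R]_(blocks r p))
    (lam : nat -> 'cV[R]_(blocks r p + blocks r p)) : Prop :=
  forall k,
    [/\ is_argmin (dlm_x_objective edge f c rho (x k) (z k) (lam k)) (x k.+1),
        is_argmin (dlm_z_objective edge f c (x k.+1) (lam k)) (z k.+1) &
        lam k.+1 = lam k
          + c *: (A_mx R p edge *m x k.+1 + B_mx R p *m z k.+1)].

Definition dlm_error (f : 'I_n -> 'cV[R]_p -> R) (rho : R)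
    (x : nat -> 'cV[R]_(blocks n p)) (k : nat) : 'cV[R]_(blocks n p) :=
  grad (aggregate f) (x k) + rho *: (x k.+1 - x k)
  - grad (aggregate f) (x k.+1).

End DLM.

(* Main.v *)
(** The Hessian bounds make each local cost convex with an upper quadratic
    bound, so its gradient is cocoercive (Baillon-Haddad):
    [|d|^2 <= M <d, e>] for [d] the gradient increment over the step [e].
    Summing over the blocks gives the same inequality for the aggregate cost;
    the error vector is [rho e - d], and expanding its squared norm with
    [<d, e> >= 0] and [|d|^2 <= M^2 |e|^2] bounds it by
    [(rho^2 + M^2) |e|^2]. Cocoercivity only uses the quadratic forms of the
    Hessians, so their symmetry plays no role. *)
Require Import Defs.
From mathcomp Require Import all_boot all_order all_algebra.
From mathcomp Require Import all_classical all_reals all_analysis.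
From mathcomp Require Import ring lra.
Set Implicit Arguments.
Unset Strict Implicit.
Unset Printing Implicit Defensive.
Import Order.TTheory GRing.Theory Num.Theory.
Import numFieldNormedType.Exports.
Local Open Scope classical_set_scope.
Local Open Scope ring_scope.

Section DotProduct.
Context {R : realType} {n : nat}.
Implicit Types u v w : 'cV[R]_n.

Lemma dotvE u v : dotv u v = \sum_i u i 0 * v i 0.
Proof. by rewrite /dotv mxE; apply: eq_bigr => i _; rewrite mxE. Qed.

Lemma dotvC u v : dotv u v = dotv v u.
Proof. by rewrite !dotvE; apply: eq_bigr => i _; rewrite mulrC. Qed.

Lemma dotvDl u v w : dotv (u + v) w = dotv u w + dotv v w.
Proof. by rewrite /dotv linearD/= mulmxDl mxE. Qed.

Lemma dotvZl a u w : dotv (a *: u) w = a * dotv u w.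
Proof. by rewrite /dotv linearZ/= -scalemxAl mxE. Qed.

Lemma dotvBl u v w : dotv (u - v) w = dotv u w - dotv v w.
Proof. by rewrite -scaleN1r dotvDl dotvZl mulN1r. Qed.

Lemma dotvDr u v w : dotv w (u + v) = dotv w u + dotv w v.
Proof. by rewrite dotvC dotvDl !(dotvC w). Qed.

Lemma dotvZr a u w : dotv w (a *: u) = a * dotv w u.
Proof. by rewrite dotvC dotvZl (dotvC w). Qed.

Lemma dotvBr u v w : dotv w (u - v) = dotv w u - dotv w v.
Proof. by rewrite dotvC dotvBl !(dotvC w). Qed.

Lemma dotv_ge0 u : 0 <= dotv u u.
Proof. by rewrite dotvE sumr_ge0// => i _; rewrite -expr2 sqr_ge0. Qed.

End DotProduct.

Lemma dotv_blocks (R : realType) k p (u v : 'cV[R]_(blocks k p)) :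
  dotv u v = \sum_i dotv (submxcol u i) (submxcol v i).
Proof.
rewrite /dotv -{1}(submxcolK u) -{1}(submxcolK v) tr_mxcol mul_mxrow_mxcol.
by rewrite summxE.
Qed.

Section LineDerivatives.
Context {R : realType}.

(** The difference quotient of the restriction at [t] is literally that of [f] at [x + t *: v] in
    direction [v], so the limits agree. *)
Lemma is_derive_line (V W : normedModType R) (f : V -> W) (x v : V) (t : R) :
  derivable f (x + t *: v) v ->
  is_derive t 1 (fun s : R => f (x + s *: v)) ('D_v f (x + t *: v)).
Proof.
rewrite /derivable /derive => df.
have quotE : (fun h : R => h^-1 *: (((fun s : R => f (x + s *: v)) \o shift t)
      (h *: 1) - f (x + t *: v))) =
    (fun h => h^-1 *: ((f \o shift (x + t *: v)) (h *: v) - f (x + t *: v))).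
  apply/funext => h /=; congr (_ *: (f _ - _)).
  by rewrite [_%:A]mulr1 scalerDl addrCA.
by split; rewrite /derivable /derive /= quotE.
Qed.

Lemma is_derive_dotvl n (u : R -> 'cV[R]_n) (du w : 'cV[R]_n) (t : R) :
  is_derive t 1 u du -> is_derive t 1 (fun s => dotv (u s) w) (dotv du w).
Proof.
move=> [u_t <-]; have /derivable_mxP ui_t := u_t.
have -> : (fun s => dotv (u s) w) = \sum_i (w i 0 \*: (fun s => u s i 0)).
  by apply/funext => s; rewrite dotvE fct_sumE; apply: eq_bigr => i _; rewrite mulrC.
have -> : dotv ('D_1 u t) w = \sum_i w i 0 *: 'D_1 (fun s => u s i 0) t.
  by rewrite dotvE derive_mx//; apply: eq_bigr => i _; rewrite mxE mulrC.
by apply: is_derive_sum => i; apply: is_deriveZ; exact: derivableP.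
Qed.

(** Two uses of the mean value theorem: [F 1 - F 0 = G c], then [G c - G 0 = H b * c]. This is the
    second-order Taylor bound, with no continuity asked of [H]. *)
Lemma increment_ge_derive (F G H : R -> R) :
  (forall t : R, is_derive t 1 F (G t)) -> (forall t : R, is_derive t 1 G (H t)) ->
  (forall t, 0 <= H t) -> G 0 <= F 1 - F 0.
Proof.
move=> FG GH H0.
have cont (f df : R -> R) a b : (forall t : R, is_derive t 1 f (df t)) ->
    {within `[a, b], continuous f}.
  move=> fdf; apply: derivable_within_continuous => t _.
  exact: (@ex_derive _ _ _ _ _ _ _ (fdf t)).
have [c c01 ->] := MVT (@ltr01 R) (fun t _ => FG t) (cont _ _ _ _ FG).
have c0 : 0 < c by move: c01; rewrite in_itv/= => /andP[].
have [b _ Gcb] := MVT c0 (fun t _ => GH t) (cont _ _ _ _ GH).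
by rewrite subr0 mulr1 -subr_ge0 Gcb mulr_ge0// subr0 ltW.
Qed.

End LineDerivatives.

Section Gradient.
Context {R : realType} {n : nat}.
Implicit Types (f : 'cV[R]_n -> R) (x y v : 'cV[R]_n).

Lemma cV_sum_delta v : v = \sum_i v i 0 *: delta_mx i 0.
Proof.
rewrite {1}[v]matrix_sum_delta; apply: eq_bigr => i _.
by rewrite big_ord1.
Qed.

Lemma derive_grad f x v : differentiable f x -> 'D_v f x = dotv (grad f x) v.
Proof.
move=> df; rewrite deriveE// {1}[v]cV_sum_delta linear_sum/= dotvE.
by apply: eq_bigr => i _; rewrite linearZ/= mxE deriveE// mulrC.
Qed.

Lemma derive_hessian f x v : differentiable (grad f) x ->
  'D_v (grad f) x = hessian f x *m v.
Proof.
move=> df; rewrite deriveE// {1}[v]cV_sum_delta linear_sum/=.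
apply/colP => i; rewrite mxE summxE; apply: eq_bigr => j _.
rewrite linearZ/= mxE mulrC -deriveE// derive_mx; last exact: diff_derivable.
rewrite !mxE; congr (_ * _).
by under eq_fun do rewrite mxE.
Qed.

(** The inner product is the slope of [f] along the line, so this is the second derivative of [f]
    there. *)
Lemma is_derive_grad_line f x v (t : R) : twice_differentiable f ->
  is_derive t 1 (fun s : R => dotv (grad f (x + s *: v)) v)
    (dotv v (hessian f (x + t *: v) *m v)).
Proof.
move=> [_ d2f]; have /is_derive_line := diff_derivable (v := v) (d2f (x + t *: v)).
by rewrite derive_hessian// dotvC => /is_derive_dotvl.
Qed.

Lemma convex_increment f x v : twice_differentiable f ->
  (forall y, loewner_le 0 (hessian f y)) ->
  dotv (grad f x) v <= f (x + v) - f x.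
Proof.
move=> tdf hess0; have [df _] := tdf.
have := @increment_ge_derive _ (fun s => f (x + s *: v))
  (fun s => dotv (grad f (x + s *: v)) v)
  (fun s => dotv v (hessian f (x + s *: v) *m v)).
rewrite /= scale0r addr0 scale1r; apply => t; last first.
- by have := hess0 (x + t *: v) v; rewrite subr0.
- exact: is_derive_grad_line.
- rewrite -derive_grad//; apply: is_derive_line; exact: diff_derivable.
Qed.

Lemma smooth_increment f x v M : twice_differentiable f ->
  (forall y, loewner_le (hessian f y) M%:M) ->
  f (x + v) - f x <= dotv (grad f x) v + M / 2 * dotv v v.
Proof.
move=> tdf hessM; have [df _] := tdf.
pose K := M * dotv v v.
(* [K] dominates the second derivative of [f] along the line, so a parabola of curvature [K] minus
   [f] is convex there. *)
have := @increment_ge_derive _ (fun s => K / 2 * s ^+ 2 - f (x + s *: v))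
  (fun s => K * s - dotv (grad f (x + s *: v)) v)
  (fun s => K - dotv v (hessian f (x + s *: v) *m v)).
rewrite /= scale0r addr0 scale1r => le_incr.
suff : K * 0 - dotv (grad f x) v <=
    K / 2 * 1 ^+ 2 - f (x + v) - (K / 2 * 0 ^+ 2 - f x) by rewrite /K; lra.
apply: le_incr => t.
- apply: is_deriveB; last first.
    by rewrite -derive_grad//; apply: is_derive_line; exact: diff_derivable.
  have -> : K * t = K / 2 *: (2 * t ^+ 1 *: 1).
    by rewrite /GRing.scale/=; field.
  by apply: is_deriveZ; exact: (is_deriveX 2 (is_derive_id t 1)).
- apply: is_deriveB; last exact: is_derive_grad_line.
  by rewrite -{2}[K]mulr1; apply: is_deriveZ.
- by have := hessM (x + t *: v) v; rewrite mulmxBl mul_scalar_mx dotvBr dotvZr.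
Qed.

Lemma grad_cocoercive f x y M : twice_differentiable f -> 0 < M ->
  (forall z, loewner_le 0 (hessian f z)) ->
  (forall z, loewner_le (hessian f z) M%:M) ->
  dotv (grad f y - grad f x) (grad f y - grad f x) <=
    M * dotv (grad f y - grad f x) (y - x).
Proof.
move=> tdf M0 hess0 hessM.
(* The function [z |-> f z - <grad f a, z>] is convex and minimal at [a]; bound
   its value there by the one at [b - d / M], the minimizer of its quadratic
   upper bound at [b]. *)
have gap a b : dotv (grad f b - grad f a) (grad f b - grad f a) <=
    2 * M * (f b - f a - dotv (grad f a) (b - a)).
  set d := grad f b - grad f a; pose s := - M^-1 *: d.
  have dd : dotv d d = dotv (grad f b) d - dotv (grad f a) d by rewrite -dotvBl.
  (* The value [f (b + s)] bounds one inequality from above and the other from below, so it cancels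
     in the sum. *)
  have := lerD (convex_increment a (b + s - a) tdf hess0)
    (smooth_increment b s tdf hessM).
  rewrite [a + _]addrC subrK (addrAC b) /s.
  move: d (b - a) dd {s} => d e dd.
  rewrite !(dotvDr, dotvZr, dotvZl) => le_fab.
  have {}le_fab : M^-1 * dotv d d / 2 <= f b - f a - dotv (grad f a) e.
    (* Net decrease over the step [- M^-1 *: d]: linear gain minus quadratic cost. *)
    have -> : M^-1 * dotv d d / 2 =
        M^-1 * dotv d d - M / 2 * (- M^-1 * (- M^-1 * dotv d d)).
      by field; rewrite gt_eqF.
    by rewrite {1}dd; lra.
  have := ler_wpM2l (ltW (mulr_gt0 (ltr0n R 2) M0)) le_fab.
  by congr (_ <= _); field; rewrite gt_eqF.
(* Adding the gaps with the points exchanged cancels the values of [f] and leaves twice the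
   claim. *)
have := gap x y; have := gap y x.
rewrite !(dotvBl, dotvBr); lra.
Qed.

End Gradient.

Section Aggregate.
Context {R : realType} {n p : nat}.

(** [tagnat.Rank i j] is the flat index of coordinate [j] of block [i]. *)
Lemma submxcol_delta (i l : 'I_n) (j : 'I_p) :
  submxcol (delta_mx (tagnat.Rank i j) 0 : 'cV[R]_(blocks n p)) l =
  if l == i then delta_mx j 0 else 0.
Proof.
apply/colP => k; rewrite !mxE andbT -val_eqE tagnat.eq_Rank.
by case: eqP => _; rewrite mxE ?andbT.
Qed.

Lemma is_derive_submxcol (f : 'cV[R]_p -> R) (x v : 'cV[R]_(blocks n p)) i :
  differentiable f (submxcol x i) ->
  is_derive x v (fun y => f (submxcol y i)) ('D_(submxcol v i) f (submxcol x i)).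
Proof.
move=> /(diff_derivable (v := submxcol v i)); rewrite /derivable /derive => df.
have quotE : (fun h : R => h^-1 *: (((fun y => f (submxcol y i)) \o shift x)
      (h *: v) - f (submxcol x i))) =
    (fun h => h^-1 *: ((f \o shift (submxcol x i)) (h *: submxcol v i)
      - f (submxcol x i))).
  apply/funext => h /=; congr (_ *: (f _ - _)).
  by apply/colP => k; rewrite !mxE.
by split; rewrite /derivable /derive /= quotE.
Qed.

Lemma submxcol_grad_aggregate (f : 'I_n -> 'cV[R]_p -> R) x i :
  (forall i y, differentiable (f i) y) ->
  submxcol (grad (aggregate f) x) i = grad (f i) (submxcol x i).
Proof.
move=> df; apply/colP => j; rewrite !mxE.
have -> : aggregate f = \sum_l (fun y => f l (submxcol y l)).
  by apply/funext => y; rewrite fct_sumE.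
have /@derive_val -> := is_derive_sum (fun l =>
  is_derive_submxcol (delta_mx (tagnat.Rank i j) 0) (df l (submxcol x l))).
(* A coordinate direction of block [i] vanishes on every other block, so only the summand [i]
   survives. *)
rewrite (bigD1 i)//= submxcol_delta eqxx big1 ?addr0// => l /negPf li.
by rewrite submxcol_delta li derive0.
Qed.

Lemma grad_aggregate_cocoercive (f : 'I_n -> 'cV[R]_p -> R) x y M : 0 < M ->
  (forall i, twice_differentiable (f i)) ->
  (forall i z, loewner_le 0 (hessian (f i) z)) ->
  (forall i z, loewner_le (hessian (f i) z) M%:M) ->
  dotv (grad (aggregate f) y - grad (aggregate f) x)
       (grad (aggregate f) y - grad (aggregate f) x) <=
    M * dotv (grad (aggregate f) y - grad (aggregate f) x) (y - x).
Proof.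
move=> M0 tdf hess0 hessM; have df i z := (tdf i).1 z.
rewrite !dotv_blocks mulr_sumr; apply: ler_sum => i _.
by rewrite !submxcolB !submxcol_grad_aggregate//; exact: grad_cocoercive.
Qed.

End Aggregate.

Theorem proposition3 (R : realType) (n r p : nat)
  (edge : 'I_r -> 'I_n * 'I_n) (f : 'I_n -> 'cV[R]_p -> R) (c rho : R)
  (x : nat -> 'cV[R]_(blocks n p)) (z : nat -> 'cV[R]_(blocks r p))
  (lam : nat -> 'cV[R]_(blocks r p + blocks r p))
  (gamma_u Gamma_u gamma_o m M L : R)
  (hnet : connected_network edge)
  (hc : 0 < c) (hrho : 0 < rho)
  (hdlm : dlm_recursion edge f c rho x z lam)
  (* initialization; alpha 0 and beta 0 are the two halves of lam 0 *)
  (hab : usubmx (lam 0%N) = - dsubmx (lam 0%N))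
  (hz : unoriented_incidence R p edge *m x 0%N = 2 *: z 0%N)
  (ha : column_space (oriented_incidence R p edge) (usubmx (lam 0%N)))
  (hgamma_u : 0 < gamma_u)
  (hEu : forall s : R, singular_value (unoriented_incidence R p edge) s ->
    gamma_u <= s <= Gamma_u)
  (hgamma_o : 0 < gamma_o)
  (hEo : singular_value (oriented_incidence R p edge) gamma_o)
  (hEo_min : forall s : R, singular_value (oriented_incidence R p edge) s ->
    s != 0 -> gamma_o <= s)
  (hf : forall i, twice_differentiable (f i))
  (hm : 0 < m) (hmM : m <= M)
  (hhess : forall i y,
    loewner_le m%:M (hessian (f i) y) /\ loewner_le (hessian (f i) y) M%:M)
  (hL : forall i y yhat,
    spectral_norm (hessian (f i) y - hessian (f i) yhat) <= L * enorm (y - yhat)) :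
  forall k : nat,
    enorm (dlm_error f rho x k) <= (rho + M) * enorm (x k.+1 - x k).
Proof.
move=> k; rewrite /dlm_error; set d := grad _ (x k.+1).
have M0 : 0 < M by exact: lt_le_trans hmM.
have hess0 i y : loewner_le 0 (hessian (f i) y).
  move=> v; have := (hhess i y).1 v.
  rewrite mulmxBl mul_scalar_mx dotvBr dotvZr subr0 subr_ge0; apply: le_trans.
  by rewrite mulr_ge0 ?dotv_ge0// ltW.
have := @grad_aggregate_cocoercive _ _ _ f (x k) (x k.+1) M M0 hf hess0
  (fun i y => (hhess i y).2).
(* The error takes the form [rho *: e - g], with [g] the gradient increment and [e] the step. *)
rewrite -/d [grad _ _ + _]addrC -addrA -(opprB d).
move: (d - _) (x k.+1 - x k) => g e coco.
have gg0 := dotv_ge0 g; have ee0 := dotv_ge0 e.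
have ge0 : 0 <= dotv g e by rewrite -(pmulr_rge0 _ M0) (le_trans gg0).
have ggM : dotv g g <= M ^+ 2 * dotv e e.
  (* Cauchy-Schwarz is bypassed: by cocoercivity, the squared norm of [g - M *: e] is at most
     [M ^+ 2 * dotv e e - dotv g g]. *)
  have := dotv_ge0 (g - M *: e).
  by rewrite !(dotvBl, dotvBr, dotvZl, dotvZr) (dotvC e g); lra.
have rM0 : 0 <= rho + M by rewrite addr_ge0 ?ltW.
rewrite /enorm -[X in X * _](ger0_norm rM0) -sqrtr_sqr -sqrtrM ?sqr_ge0//.
rewrite ler_sqrt ?mulr_ge0 ?sqr_ge0//.
rewrite !(dotvBl, dotvBr, dotvZl, dotvZr) (dotvC e g).
have : 0 <= rho * dotv g e by rewrite mulr_ge0// ltW.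
have : 0 <= rho * M * dotv e e by rewrite !mulr_ge0// ltW.
lra.
Qed.
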